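(* Let $p$ be a Sophie Germain prime with $p\equiv 1, 3$ or $5 \pmod 8$, and let $k\geq 1$ be an integer. Then the only non-negative integer solutions of the equation $-p^x+(2^{k}(2p+1))^y=z^2$ are $(x,y,z)=(0,0,0)$ (for any $p,k$) and $(p,k,x,y,z)=(3,1,3,2,13)$, $(3,2,3,1,1)$, $(3,2,1,1,5)$, $(11,2,1,1,9)$.
   Context: A prime $p$ is called a Sophie Germain prime if $2p+1$ is also prime. *)

(* Defs.v *)
From mathcomp Require Import all_boot all_order all_algebra.
Set Implicit Arguments.
Unset Strict Implicit.
Unset Printing Implicit Defensive.

Definition sophie_germain (p : nat) : bool := prime p && prime (2 * p + 1).

(* Main.v *)
Require Import Defs.
From mathcomp Require Import all_boot all_order all_algebra.
From mathcomp Require Import zify.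
Set Implicit Arguments.
Unset Strict Implicit.
Unset Printing Implicit Defensive.
Import GRing.Theory.
Local Open Scope ring_scope.

(* Over nat the equation reads z ^ 2 + p ^ x = (2 ^ k * (2 * p + 1)) ^ y.
   For y > 0 the right-hand side is even, so z is odd and z ^ 2 = 1 mod 8, while
   p ^ x = 1, 3 or 5 mod 8: the left-hand side is not divisible by 8. Hence
   k * y < 3, and each of the three remaining equations is settled by size,
   congruences, or factoring a difference of squares. *)

Section Nat.
Local Open Scope nat_scope.

Lemma sqrn_mod8 z : odd z -> z ^ 2 = 1 %[mod 8].
Proof.
move=> oz; rewrite -modnXm.
have : z %% 8 \in [:: 1; 3; 5; 7] by rewrite !inE; lia.
by rewrite !inE => /or4P[] /eqP->.
Qed.

(** Since [p] is odd, [p ^ 2] is 1 mod 8, so [p ^ x] mod 8 depends only on the parity of [x]. *)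
Lemma expn_mod8 p x :
  [\/ p = 1 %[mod 8], p = 3 %[mod 8] | p = 5 %[mod 8]] ->
  [\/ p ^ x = 1 %[mod 8], p ^ x = 3 %[mod 8] | p ^ x = 5 %[mod 8]].
Proof.
move=> hp; have op : odd p by case: hp; lia.
rewrite -(odd_double_half x) -mul2n expnD expnM.
rewrite -modnMmr -(modnXm _ 8 (p ^ 2)) sqrn_mod8 // modnXm exp1n modnMmr muln1.
by case: (odd x); [rewrite expn1 | constructor].
Qed.

Lemma exponent_lt3 p q k x y z :
    [\/ p = 1 %[mod 8], p = 3 %[mod 8] | p = 5 %[mod 8]] ->
  0 < k * y -> z ^ 2 + p ^ x = (2 ^ k * q) ^ y -> k * y < 3.
Proof.
move=> /(expn_mod8 x) hpx ky0; rewrite expnMn -expnM => e.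
rewrite ltnNge; apply/negP => ky3.
have /dvdnP[m em] : 8 %| z ^ 2 + p ^ x by rewrite e dvdn_mulr // (@dvdn_exp2l 2 3).
have oz : odd z.
  have := oddX z 2; move: em hpx; move: (z ^ 2) (p ^ x) => u v em.
  by case; lia.
have := sqrn_mod8 oz; move: em hpx; move: (z ^ 2) (p ^ x) => u v em.
by case; lia.
Qed.

Lemma eq_k1_y1 p x z : odd p -> prime p -> z ^ 2 + p ^ x <> 4 * p + 2.
Proof.
move=> op pp; have p1 := prime_gt1 pp.
case: x => [|[|[|x]]]; rewrite ?expn0 ?expn1 => e.
(* For [x = 0], the substitution [z = 2w + 1] gives [w * (w + 1) = p]: an even product equal to an
   odd prime. *)
- have oz : odd z by have := oddX z 2; lia.
  have [w ew] : exists w, z = w.*2.+1 by exists z./2; lia.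
  have ow : ~~ odd (w * w.+1) by rewrite oddM /= andbN.
  have ep : w * w.+1 = p by move: e; rewrite ew -mulnn -muln2; nia.
  by rewrite ep op in ow.
(* For [x = 1], [z ^ 2 = 3 * p + 2], but 2 is not a square mod 3. *)
- by have : (z ^ 2 %% 3 = 2); [lia|];
    rewrite -modnXm; case: (z %% 3) (@ltn_pmod z 3 isT) => [|[|[|]]].
- have p4 : p <= 4 by rewrite -!mulnn in e; nia.
  have p3 : p = 3 by lia.
  by move: e; rewrite p3 -!mulnn; case: z => [|[|[|z]]]; nia.
- have le3 : p ^ 3 <= p ^ x.+3 by rewrite leq_exp2l.
  have ge9 : 3 ^ 2 * p <= p ^ 3.
    by rewrite [p ^ 3]expnSr leq_mul2r leq_exp2r //; lia.
  by move: (p ^ 3) (p ^ _) le3 ge9 e => u v; lia.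
Qed.

(** The difference of squares splits [p ^ x] into two factors, both powers of [p], whose sum is
    [8 * p + 4]. *)
Lemma eq_k1_y2 p x z : odd p -> prime p ->
  z ^ 2 + p ^ x = (2 * (2 * p + 1)) ^ 2 -> [/\ p = 3, x = 3 & z = 13].
Proof.
move=> op pp e; have p1 := prime_gt1 pp.
have px0 : 0 < p ^ x by rewrite expn_gt0; lia.
have zlt : z < 2 * (2 * p + 1) by rewrite -ltn_sqr -e; lia.
have fact : p ^ x = (2 * (2 * p + 1) - z) * (2 * (2 * p + 1) + z).
  by rewrite -subn_sqr -e; lia.
have /(dvdn_pfactor _ _ pp)[a _ ea] : 2 * (2 * p + 1) - z %| p ^ x.
  by rewrite fact dvdn_mulr.
have /(dvdn_pfactor _ _ pp)[b _ eb] : 2 * (2 * p + 1) + z %| p ^ x.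
  by rewrite fact dvdn_mull.
case: b eb => [|b] eb; first by lia.
(* If both exponents were positive, [p] would divide [8 * p + 4], hence 4. So the smaller factor is
   1, the larger is [8 * p + 3], and [p] divides 3. *)
case: a ea => [|a] ea; last first.
  have : p %| 8 * p + 4.
    have -> : 8 * p + 4 = p ^ a.+1 + p ^ b.+1.
      by rewrite -ea -eb; lia.
    by rewrite !expnS -mulnDr dvdn_mulr.
  rewrite dvdn_addr ?dvdn_mull // => d4; have p4 : p <= 4 by exact: dvdn_leq d4.
  have p3 : p = 3 by lia.
  by rewrite p3 in d4.
have e3 : p ^ b.+1 = 8 * p + 3 by lia.
have p3 : p = 3.
  have d3 : p %| 3 by rewrite -(dvdn_addr _ (dvdn_mull 8 (dvdnn p))) -e3 expnS dvdn_mulr.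
  have : p <= 3 by exact: dvdn_leq d3.
  by lia.
subst p; split=> //; last by lia.
apply/eqP; rewrite -(@eqn_exp2l 3) // fact; apply/eqP; lia.
Qed.

Lemma eq_k2_y1 p x z : odd p -> prime p ->
  z ^ 2 + p ^ x = 4 * (2 * p + 1) ->
  [\/ [/\ p = 3, x = 3 & z = 1], [/\ p = 3, x = 1 & z = 5] |
      [/\ p = 11, x = 1 & z = 9]].
Proof.
move=> op pp e; have p1 := prime_gt1 pp.
have px0 : 0 < p ^ x by rewrite expn_gt0; lia.
case: x px0 e => [|[|[|x]]] px0; rewrite ?expn0 ?expn1 => e.
(* For [x = 0], [z ^ 2 = 8 * p + 3] would be an odd square that is 3 mod 8. *)
- have oz : odd z by have := oddX z 2; lia.
  by have := sqrn_mod8 oz; lia.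
(* For [x = 1], subtracting 4 gives [(z - 2) * (z + 2) = 7 * p], and [p] divides one of the
   factors. *)
- have z2 : 2 <= z by rewrite -!mulnn in e; nia.
  have fact : (z - 2) * (z + 2) = 7 * p by rewrite -(subn_sqr z 2); lia.
  have : p %| (z - 2) * (z + 2) by rewrite fact dvdn_mull.
  rewrite Euclid_dvdM // => /orP[] /dvdnP[m em].
  + have fm : m * (m * p + 4) = 7 by nia.
    have m1 : m = 1 by nia.
    by subst m; constructor 2; split; lia.
  (* This is [m * (m * p - 4) = 7] free of truncated subtraction; only [m = 1] survives, giving
     [p = 11]. *)
  + have fm : m * (m * p) = 7 + 4 * m by nia.
    have m7 : m <= 7 by nia.
    by move: m m7 em fm => [|[|[|[|[|[|[|[|//]]]]]]]] _ em fm; try lia;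
      constructor 3; split; lia.
(* For [x = 2], [z ^ 2 + (p - 4) ^ 2 = 20] bounds both unknowns, leaving a finite check. *)
- have p8 : p <= 8 by rewrite -!mulnn in e; nia.
  have z5 : z <= 5 by rewrite -!mulnn in e; nia.
  by move: p p8 op z z5 e {p1 pp px0} =>
    [|[|[|[|[|[|[|[|[|//]]]]]]]]] _ // _ [|[|[|[|[|[|//]]]]]].
(* For larger exponents, [p >= 5] would give at least [25 * p], more than [8 * p + 4]. With [p = 3]
   the total is 28, below [3 ^ 4]. *)
- have le3 : p ^ 3 <= p ^ x.+3 by rewrite leq_exp2l.
  have p4 : p < 5.
    rewrite ltnNge; apply/negP => p5.
    have : 5 ^ 2 * p <= p ^ 3 by rewrite [p ^ 3]expnSr leq_mul2r leq_exp2r ?p5 ?orbT.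
    by move: (p ^ 3) (p ^ _) le3 e => u v; lia.
  have p3 : p = 3 by lia.
  subst p; have x0 : x = 0.
    have : 3 ^ x.+3 < 3 ^ 4.
      by apply: (@leq_ltn_trans (4 * (2 * 3 + 1))); rewrite // -e leq_addl.
    by rewrite ltn_exp2l //; lia.
  by subst x; constructor; split=> //; rewrite -!mulnn in e; nia.
Qed.
End Nat.

Theorem theorem4p5 (p k x y z : nat)
    (hp : sophie_germain p)
    (hp8 : [\/ p = 1 %[mod 8], p = 3 %[mod 8] | p = 5 %[mod 8]])
    (hk : (1 <= k)%N) :
  - p%:Z ^+ x + (2 ^+ k * (2 * p%:Z + 1)) ^+ y = z%:Z ^+ 2 <->
  [\/ (x, y, z) = (0, 0, 0)%N,
      (p, k, x, y, z) = (3, 1, 3, 2, 13)%N,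
      (p, k, x, y, z) = (3, 2, 3, 1, 1)%N |
      (p, k, x, y, z) = (3, 2, 1, 1, 5)%N \/
      (p, k, x, y, z) = (11, 2, 1, 1, 9)%N].
Proof.
have toN : - p%:Z ^+ x + (2 ^+ k * (2 * p%:Z + 1)) ^+ y = z%:Z ^+ 2 <->
    (z ^ 2 + p ^ x = (2 ^ k * (2 * p + 1)) ^ y)%N.
  have -> : - p%:Z ^+ x + (2 ^+ k * (2 * p%:Z + 1)) ^+ y =
      - (p ^ x)%N%:Z + ((2 ^ k * (2 * p + 1)) ^ y)%N%:Z.
    by rewrite -!natz !(natrX, natrM, natrD).
  have -> : z%:Z ^+ 2 = (z ^ 2)%N%:Z by rewrite -!natz natrX.
  by move: (z ^ 2)%N (p ^ x)%N (_ ^ y)%N => a b c; lia.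
rewrite toN; split; last first.
  by case=> [[-> -> ->]|[-> -> -> -> ->]|[-> -> -> -> ->]|
    [[-> -> -> -> ->]|[-> -> -> -> ->]]].
have pp : prime p by case/andP: hp.
have op : odd p by case: hp8; lia.
(* For [y = 0] the right-hand side is 1 and [p ^ x] is positive, so [z = 0] and [p ^ x = 1]. *)
case: (posnP y) => [->|y0].
  rewrite expn0; have := ltn_expl x (prime_gt1 pp).
  case: z {toN} => [|z]; rewrite -mulnn => ltx e; last by nia.
  have -> : x = 0%N by lia.
  by constructor.
move=> e; have ky : (k * y < 3)%N by apply: exponent_lt3 e => //; rewrite muln_gt0 hk.
have [[k1 y1]|[k1 y2]|[k2 y1]] :
  [\/ k = 1 /\ y = 1, k = 1 /\ y = 2 | k = 2 /\ y = 1]%N.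
  have [k2 y2] : (k <= 2 /\ y <= 2)%N by nia.
  by move: k y hk y0 ky k2 y2 {hp8 toN e} => [|[|[|//]]] [|[|[|//]]] // *; constructor.
- by subst; case: (@eq_k1_y1 p x z) => //; rewrite e expn1; lia.
- by subst; case: (@eq_k1_y2 p x z) => // -> -> ->; constructor 2.
- subst; case: (@eq_k2_y1 p x z) => // -[-> -> ->]; first by constructor 3.
  + by constructor 4; left.
  + by constructor 4; right.
Qed.
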